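(* Let $\gamma:I\to\mathbb{E}^4$ be a smooth unit speed curve on an interval $I$ with parallel transport frame $\{T,M_1,M_2,M_3\}$, let $r\neq 0$ be a real constant, and let $M$ be the tube surface in $\mathbb{E}^4$ parametrized by $$X(u,v)=\gamma(u)+r\left(M_2(u)\cos v+M_3(u)\sin v\right).$$ If $\gamma$ is a straight line, then $M$ is a linear Weingarten surface, i.e. there exist $a,b,c\in\mathbb{R}$ with $(a,b,c)\neq(0,0,0)$ such that the Gaussian curvature $K$ and mean curvature $H$ of $M$ satisfy $aK+bH=c$ at every point of $M$.
   Context: A parallel transport frame along a smooth unit speed curve $\gamma:I\to\mathbb{E}^4$ is a smooth orthonormal frame $\{T,M_1,M_2,M_3\}$ along $\gamma$ with $T=\gamma'$ satisfying $T'=k_1M_1+k_2M_2+k_3M_3$ and $M_i'=-k_iT$ for $i=1,2,3$, where $k_1,k_2,k_3:I\to\mathbb{R}$ are smooth functions. For a surface with parametrization $X(u,v)$ in $\mathbb{E}^4$, put $E=\langle X_u,X_u\rangle$, $F=\langle X_u,X_v\rangle$, $G=\langle X_v,X_v\rangle$, $W^2=EG-F^2$. The second fundamental form is $h(X_i,X_j)$ = the component normal to the surface of the corresponding second partial derivative ($X_{uu}$, $X_{uv}$, $X_{vv}$). The Gaussian curvature is $K=\frac{1}{W^2}\left(\langle h(X_u,X_u),h(X_v,X_v)\rangle-\langle h(X_u,X_v),h(X_u,X_v)\rangle\right)$, the mean curvature vector is $\overrightarrow{H}=\frac{1}{2W^2}\left(E\,h(X_v,X_v)-2F\,h(X_u,X_v)+G\,h(X_u,X_u)\right)$,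 and the mean curvature is $H=\|\overrightarrow{H}\|$. *)

(* Defs.v *)
From HB Require Import structures.
From mathcomp Require Import all_boot all_order all_algebra.
From mathcomp Require Import all_classical all_reals all_analysis.
Set Implicit Arguments.
Unset Strict Implicit.
Unset Printing Implicit Defensive.
Import Order.TTheory GRing.Theory Num.Theory.
Import numFieldNormedType.Exports.
Local Open Scope classical_set_scope.
Local Open Scope ring_scope.

(* Points and vectors of E^4 are row vectors. The norm that the library puts on
   'rV[R]_4 is the sup norm, used here only for its topology (limits and
   derivatives); the Euclidean structure is given by dot and enorm. *)
Definition dot (R : realType) (x y : 'rV[R]_4) : R := \sum_(i < 4) x 0 i * y 0 i.

Definition enorm (R : realType) (x : 'rV[R]_4) : R := Num.sqrt (dot x x).

Definition nondegenerate_interval (R : realType) (I : set R) : Prop :=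
  is_interval I /\ exists a b, [/\ I a, I b & a < b].

(* For open I this is C^oo on I. For an arbitrary interval it is smoothness up
   to the endpoints: f, outside I, is a smooth extension. When I is a
   nondegenerate interval, the derivatives of f at the points of I do not
   depend on the extension. *)
Definition smooth_on (R : realType) (V : normedModType R) (I : set R)
    (f : R -> V) : Prop :=
  exists U : set R, [/\ open U, I `<=` U &
    forall (n : nat) (x : R), U x -> derivable (derive1n n f) x 1].

Definition unit_speed (R : realType) (I : set R) (g : R -> 'rV[R]_4) : Prop :=
  forall u, I u -> enorm (derive1 g u) = 1.

Definition orthonormal4 (R : realType) (e1 e2 e3 e4 : 'rV[R]_4) : Prop :=
  [/\ [/\ dot e1 e1 = 1, dot e2 e2 = 1, dot e3 e3 = 1 & dot e4 e4 = 1],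
      [/\ dot e1 e2 = 0, dot e1 e3 = 0 & dot e1 e4 = 0] &
      [/\ dot e2 e3 = 0, dot e2 e4 = 0 & dot e3 e4 = 0]].

Record parallel_transport_frame (R : realType) (I : set R) (g : R -> 'rV[R]_4)
    (T M1 M2 M3 : R -> 'rV[R]_4) (k1 k2 k3 : R -> R) : Prop :=
  ParallelTransportFrame {
    ptf_smoothT : smooth_on I T;
    ptf_smoothM : [/\ smooth_on I M1, smooth_on I M2 & smooth_on I M3];
    ptf_smoothk : [/\ smooth_on I k1, smooth_on I k2 & smooth_on I k3];
    ptf_tangent : forall u, I u -> T u = derive1 g u;
    ptf_orthonormal : forall u, I u -> orthonormal4 (T u) (M1 u) (M2 u) (M3 u);
    ptf_dT : forall u, I u ->
      derive1 T u = k1 u *: M1 u + k2 u *: M2 u + k3 u *: M3 u;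
    ptf_dM1 : forall u, I u -> derive1 M1 u = - k1 u *: T u;
    ptf_dM2 : forall u, I u -> derive1 M2 u = - k2 u *: T u;
    ptf_dM3 : forall u, I u -> derive1 M3 u = - k3 u *: T u }.

(* The trace of the curve lies on an affine line. *)
Definition straight_line (R : realType) (I : set R) (g : R -> 'rV[R]_4) : Prop :=
  exists p d : 'rV[R]_4, d != 0 /\
    forall u, I u -> exists t : R, g u = p + t *: d.

Definition tube (R : realType) (g M2 M3 : R -> 'rV[R]_4) (r : R) :
    R -> R -> 'rV[R]_4 :=
  fun u v => g u + r *: (cos v *: M2 u + sin v *: M3 u).

Section Surface.
Variables (R : realType) (X : R -> R -> 'rV[R]_4).

Definition d_u (Y : R -> R -> 'rV[R]_4) : R -> R -> 'rV[R]_4 :=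
  fun u v => derive1 (fun s => Y s v) u.
Definition d_v (Y : R -> R -> 'rV[R]_4) : R -> R -> 'rV[R]_4 :=
  fun u v => derive1 (fun t => Y u t) v.

Definition ffE (u v : R) : R := dot (d_u X u v) (d_u X u v).
Definition ffF (u v : R) : R := dot (d_u X u v) (d_v X u v).
Definition ffG (u v : R) : R := dot (d_v X u v) (d_v X u v).
Definition ffW2 (u v : R) : R := ffE u v * ffG u v - ffF u v ^+ 2.

Definition tangent_mx (u v : R) : 'M[R]_(1 + 1, 4) :=
  col_mx (d_u X u v) (d_v X u v).

(* The row space of kermx A^T is the orthogonal complement of the row space of
   A, so this is the projection onto the normal space along the tangent one. *)
Definition normal_part (u v : R) (w : 'rV[R]_4) : 'rV[R]_4 :=
  w *m proj_mx (kermx (tangent_mx u v)^T) <<tangent_mx u v>>%MS.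

Definition h_uu (u v : R) : 'rV[R]_4 := normal_part u v (d_u (d_u X) u v).
Definition h_uv (u v : R) : 'rV[R]_4 := normal_part u v (d_v (d_u X) u v).
Definition h_vv (u v : R) : 'rV[R]_4 := normal_part u v (d_v (d_v X) u v).

Definition gauss_curvature (u v : R) : R :=
  (ffW2 u v)^-1 *
  (dot (h_uu u v) (h_vv u v) - dot (h_uv u v) (h_uv u v)).

Definition mean_curvature_vector (u v : R) : 'rV[R]_4 :=
  (2 * ffW2 u v)^-1 *:
  (ffE u v *: h_vv u v - (2 * ffF u v) *: h_uv u v + ffG u v *: h_uu u v).

Definition mean_curvature (u v : R) : R := enorm (mean_curvature_vector u v).

Definition linear_weingarten (I : set R) : Prop :=
  exists a b c : R, (a, b, c) <> (0, 0, 0) /\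
    forall u v, I u -> a * gauss_curvature u v + b * mean_curvature u v = c.

End Surface.

(* Main.v *)
Require Import Defs.
From mathcomp Require Import all_boot all_order all_algebra.
From mathcomp Require Import all_classical all_reals all_analysis.
From mathcomp Require Import ring lra.
Set Implicit Arguments.
Unset Strict Implicit.
Import Order.TTheory GRing.Theory Num.Theory.
Import numFieldNormedType.Exports.
Local Open Scope classical_set_scope.
Local Open Scope ring_scope.

(** On a straight line T stays in a fixed direction, so T' is parallel to T; it
    is also orthogonal to T, hence T' = 0 and every k_i vanishes. Then M2' and
    M3' vanish too, so that X_u = T, X_uu = 0 and X_uv = 0: the tube is flat,
    and K = 0 is the required linear relation. *)

(* The derivative at an endpoint of I is that of an extension of f beyond I; it
   is recovered along the one-sided path t |-> u + t (w - u), t -> 0+, which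
   stays in I for any other point w of I. *)
Lemma is_derive_const_on (R : realType) (V : normedModType R) (I : set R)
    (f : R -> V) (u : R) (df : V) :
  nondegenerate_interval I -> I u -> is_derive u 1 f df ->
  (forall s, I s -> f s = f u) -> df = 0.
Proof.
move=> [Iitv [a [b [Ia Ib ab]]]] Iu [dfu <-] fI.
have [w Iw wu] : exists2 w, I w & w != u.
  have [au|au] := eqVneq a u; last by exists a.
  by exists b => //; rewrite -au gt_eqF.
(* The difference quotient has its limit along the punctured filter [0^'], so the increment
   [t * (w - u)] must tend to 0 while staying nonzero; [w != u] ensures this. *)
have scale0 : t * (w - u) @[t --> 0^'+] --> 0^'.
  move=> A A0; have A0' : \forall t \near 0, t != 0 -> A t by exact: A0.
  have sc : t * (w - u) @[t --> (0 : R)] --> (0 : R).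
    rewrite -[X in _ --> X](mul0r (w - u)).
    by apply: cvgM; [exact: cvg_id|exact: cvg_cst].
  suff : \forall t \near (0 : R), 0 < t -> A (t * (w - u)) by [].
  near=> t => t0; have : t * (w - u) != 0 -> A (t * (w - u)).
    by near: t; exact: (sc _ A0').
  by apply; rewrite mulf_neq0 ?subr_eq0// gt_eqF.
(* Along this path the difference quotient still tends to the derivative, yet it is 0 as soon as
   [t < 1], since the point then lies between [u] and [w]. Uniqueness of limits concludes. *)
have := cvg_comp _ _ scale0 dfu.
move/(cvg_unique (@norm_hausdorff _ _)); apply; apply: cvg_near_cst.
near=> t => /=.
rewrite [X in f X](_ : _ = u + t * (w - u)); last first.
  by rewrite /= -[X in X + u]/(_ * 1) mulr1 addrC.
rewrite [f (_ + _)]fI ?subrr ?scaler0//.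
have t0 : 0 < t by near: t; exact: nbhs_right_gt.
have t1 : t < 1 by near: t; exact: nbhs_right_lt.
have [uw|uw] := leP u w.
- by apply: (Iitv u w) => //; apply/andP; split; nra.
- by apply: (Iitv w u) => //; apply/andP; split; nra.
Unshelve. all: by end_near. Qed.

Lemma is_derive_eq_on (R : realType) (V : normedModType R) (I : set R)
    (f1 f2 : R -> V) (u : R) (df1 df2 : V) :
  nondegenerate_interval I -> I u ->
  is_derive u 1 f1 df1 -> is_derive u 1 f2 df2 ->
  (forall s, I s -> f1 s = f2 s) -> df1 = df2.
Proof.
move=> hI Iu d1 d2 f12; apply/eqP; rewrite -subr_eq0; apply/eqP.
apply: (is_derive_const_on hI Iu (is_deriveB d1 d2)) => s Is /=.
by rewrite !fctE (f12 _ Is) (f12 _ Iu) !subrr.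
Qed.

Lemma is_derive_coord (R : realType) (n : nat) (f : R -> 'rV[R]_n) (u : R)
    (df : 'rV[R]_n) (i : 'I_n) :
  is_derive u 1 f df -> is_derive u 1 (fun s => f s 0 i) (df 0 i).
Proof.
move=> [dfu <-]; rewrite derive_mx// mxE.
by apply: derivableP; move/derivable_mxP : dfu; exact.
Qed.

(** Each minor [d 0 j * f s 0 i - d 0 i * f s 0 j] is constant for [s] in [I], because the parameter
    on the line cancels. Its derivative therefore vanishes, and a nonzero [d 0 j] determines all
    coordinates of [df] from the [j]-th one. *)
Lemma is_derive_line (R : realType) (n : nat) (I : set R) (f : R -> 'rV[R]_n)
    (u : R) (df p d : 'rV[R]_n) :
  nondegenerate_interval I -> I u -> is_derive u 1 f df -> d != 0 ->
  (forall s, I s -> exists t, f s = p + t *: d) -> exists t, df = t *: d.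
Proof.
move=> hI Iu dfu /rV0Pn[j dj] fline.
exists (df 0 j / d 0 j); apply/rowP => i; rewrite mxE.
apply: (mulfI dj); rewrite mulrA [X in _ = X * _]mulrC divfK//.
apply/eqP; rewrite -subr_eq0 [X in _ - X]mulrC; apply/eqP.
have h k := is_derive_coord k dfu.
have h1 := is_deriveB (is_deriveZ (d 0 j) (h i)) (is_deriveZ (d 0 i) (h j)).
apply: (is_derive_const_on hI Iu h1) => s Is; rewrite !fctE.
have [t fs] := fline s Is; have [t' fu] := fline u Iu.
by rewrite /= fs fu !mxE /GRing.scale/=; ring.
Qed.

(** The first derivative is needed on a full neighbourhood of [u], possibly leaving [I], so that the
    formula for $X_u$ can itself be differentiated at [u]. *)
Lemma smooth_on_is_derive (R : realType) (V : normedModType R) (I : set R)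
    (f : R -> V) (u : R) :
  smooth_on I f -> I u ->
  is_derive u 1 (derive1 f) (derive1 (derive1 f) u) /\
  \forall s \near u, is_derive (s : R) (1 : R) f (derive1 f s).
Proof.
move=> [U [oU IU fU]] Iu; split.
  by rewrite [X in is_derive _ _ _ X]derive1E; apply/derivableP/(fU 1%N)/IU.
have Uu : nbhs u U by apply: open_nbhs_nbhs; split => //; exact: IU.
apply: filterS Uu => s Us.
by rewrite derive1E; exact/derivableP/(fU 0%N).
Qed.

Lemma dotDr (R : realType) (x y z : 'rV[R]_4) :
  dot x (y + z) = dot x y + dot x z.
Proof. by rewrite -big_split/=; apply: eq_bigr => i _; rewrite mxE mulrDr. Qed.

Lemma dotZr (R : realType) (c : R) (x y : 'rV[R]_4) :
  dot x (c *: y) = c * dot x y.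
Proof. by rewrite big_distrr/=; apply: eq_bigr => i _; rewrite mxE mulrCA. Qed.

Lemma dotC (R : realType) (x y : 'rV[R]_4) : dot x y = dot y x.
Proof. by apply: eq_bigr => i _; rewrite mulrC. Qed.

Lemma dot0r (R : realType) (x : 'rV[R]_4) : dot x 0 = 0.
Proof. by rewrite -(scale0r 0) dotZr mul0r. Qed.

(** For fixed [v] the tube is linear in the triple [g], [M2], [M3], so its derivative in [u] is
    again a tube, and the lemma can be reused for $X_{uu}$. *)
Lemma is_derive_tube (R : realType) (g M2 M3 : R -> 'rV[R]_4) (r u v : R)
    (dg dM2 dM3 : 'rV[R]_4) :
  is_derive u 1 g dg -> is_derive u 1 M2 dM2 -> is_derive u 1 M3 dM3 ->
  is_derive u 1 (fun s => tube g M2 M3 r s v)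
    (dg + r *: (cos v *: dM2 + sin v *: dM3)).
Proof.
move=> g' M2' M3'.
exact: (is_deriveD g' (is_deriveZ r
  (is_deriveD (is_deriveZ (cos v) M2') (is_deriveZ (sin v) M3')))).
Qed.

Lemma d_u_tube (R : realType) (g M2 M3 : R -> 'rV[R]_4) (r u v : R) :
  is_derive u 1 g (derive1 g u) -> is_derive u 1 M2 (derive1 M2 u) ->
  is_derive u 1 M3 (derive1 M3 u) ->
  d_u (tube g M2 M3 r) u v = tube (derive1 g) (derive1 M2) (derive1 M3) r u v.
Proof.
move=> g' M2' M3'; rewrite /d_u derive1E.
by have [_ ->] := is_derive_tube r v g' M2' M3'.
Qed.

Lemma straight_line_curvatures0 (R : realType) (I : set R)
    (g T M1 M2 M3 : R -> 'rV[R]_4) (k1 k2 k3 : R -> R) (u : R) :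
  nondegenerate_interval I -> smooth_on I g -> straight_line I g ->
  parallel_transport_frame I g T M1 M2 M3 k1 k2 k3 ->
  I u -> [/\ k1 u = 0, k2 u = 0 & k3 u = 0].
Proof.
move=> hI sg [p [d [d0 gline]]] F Iu.
have Tline s : I s -> exists t, T s = t *: d.
  move=> Is; rewrite (ptf_tangent F Is).
  have [_ /nbhs_singleton g'] := smooth_on_is_derive sg Is.
  exact: is_derive_line hI Is g' d0 gline.
have [_ /nbhs_singleton T'] := smooth_on_is_derive (ptf_smoothT F) Iu.
have [] : exists t, derive1 T u = t *: d.
  apply: (is_derive_line (p := 0) hI Iu T' d0) => s Is.
  by have [t ->] := Tline s Is; exists t; rewrite add0r.
rewrite (ptf_dT F Iu) => m Tm; have [t Tt] := Tline u Iu.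
have [[TT M11 M22 M33] [T1 T2 T3] [M12 M13 M23]] := ptf_orthonormal F Iu.
have : dot (T u) (m *: d) = 0.
  by rewrite -Tm !dotDr !dotZr T1 T2 T3 !mulr0 !addr0.
(* The unit vector [T u] equals [t *: d], so [dot (T u) d] cannot vanish; orthogonality of [m *: d]
   to [T u] then forces [m = 0]. *)
have td : t * dot (T u) d = 1 by rewrite -dotZr -Tt.
rewrite dotZr => /eqP; rewrite mulf_eq0 => /orP[/eqP m0|/eqP d0']; last first.
  by move: td; rewrite d0' mulr0 => /esym/eqP; rewrite oner_eq0.
(* Pairing the vanishing combination of the [M]s with each frame vector isolates its coefficient. *)
rewrite m0 scale0r in Tm; split.
- by rewrite -(dot0r (M1 u)) -Tm !dotDr !dotZr M11 M12 M13
    !mulr0 mulr1 !addr0.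
- by rewrite -(dot0r (M2 u)) -Tm !dotDr !dotZr (dotC _ (M1 u)) M22 M12 M23
    !mulr0 mulr1 addr0 add0r.
- by rewrite -(dot0r (M3 u)) -Tm !dotDr !dotZr (dotC _ (M1 u))
    (dotC _ (M2 u)) M33 M13 M23 !mulr0 mulr1 !add0r.
Qed.

Theorem proposition19 (R : realType) (I : set R) (g : R -> 'rV[R]_4)
    (T M1 M2 M3 : R -> 'rV[R]_4) (k1 k2 k3 : R -> R) (r : R)
    (hI : nondegenerate_interval I)
    (g_smooth : smooth_on I g)
    (g_unit : unit_speed I g)
    (frame : parallel_transport_frame I g T M1 M2 M3 k1 k2 k3)
    (r_neq0 : r != 0)
    (g_line : straight_line I g) :
  linear_weingarten (tube g M2 M3 r) I.
Proof.
(* The relation chosen is $1\cdot K+0\cdot H=0$. *)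
exists 1, 0, 0; split; first by case=> /eqP; rewrite oner_eq0.
have k0 u := @straight_line_curvatures0 _ _ _ _ _ _ _ _ _ _ u
  hI g_smooth g_line frame.
have dT u : I u -> derive1 T u = 0.
  move=> Iu; have [k10 k20 k30] := k0 u Iu.
  by rewrite (ptf_dT frame Iu) k10 k20 k30 !scale0r !addr0.
have dM2 u : I u -> derive1 M2 u = 0.
  move=> Iu; have [_ k20 _] := k0 u Iu.
  by rewrite (ptf_dM2 frame Iu) k20 oppr0 scale0r.
have dM3 u : I u -> derive1 M3 u = 0.
  move=> Iu; have [_ _ k30] := k0 u Iu.
  by rewrite (ptf_dM3 frame Iu) k30 oppr0 scale0r.
have [_ sM2 sM3] := ptf_smoothM frame.
move=> u v Iu; rewrite mul1r mul0r addr0.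
have [g'' g'] := smooth_on_is_derive g_smooth Iu.
have [M2'' M2'] := smooth_on_is_derive sM2 Iu.
have [M3'' M3'] := smooth_on_is_derive sM3 Iu.
have [_ /nbhs_singleton T'] := smooth_on_is_derive (ptf_smoothT frame) Iu.
have Xu v' : \forall s \near u, d_u (tube g M2 M3 r) s v' =
    tube (derive1 g) (derive1 M2) (derive1 M3) r s v'.
  by apply: filterS3 g' M2' M3' => s; exact: d_u_tube.
(* [T] and [derive1 g] agree only on [I], and [derive1 M2], [derive1 M3] vanish only there, so at an
   endpoint the second derivatives are obtained from values inside [I]. *)
have g''0 : derive1 (derive1 g) u = 0.
  rewrite -(dT u Iu); apply: (is_derive_eq_on hI Iu g'' T').
  by move=> s Is; rewrite (ptf_tangent frame Is).
have M2''0 : derive1 (derive1 M2) u = 0.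
  by apply: (is_derive_const_on hI Iu M2'') => s Is; rewrite !dM2.
have M3''0 : derive1 (derive1 M3) u = 0.
  by apply: (is_derive_const_on hI Iu M3'') => s Is; rewrite !dM3.
have Xuu : d_u (d_u (tube g M2 M3 r)) u v = 0.
  rewrite [LHS]derive1E (near_eq_derive _ (Xu v)).
  have [_ ->] := is_derive_tube r v g'' M2'' M3''.
  by rewrite g''0 M2''0 M3''0 !(scaler0, addr0).
have Xuv : d_v (d_u (tube g M2 M3 r)) u v = 0.
  (* At a fixed [u] in [I] the terms carrying [v] drop out of $X_u$, leaving the same vector for all
     [v]. *)
  have Xut : d_u (tube g M2 M3 r) u = cst (derive1 g u).
    apply/funext => t; rewrite (nbhs_singleton (Xu t)) /tube.
    by rewrite (dM2 _ Iu) (dM3 _ Iu) !(scaler0, addr0).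
  rewrite /d_v (_ : (fun t => _) = cst (derive1 g u)); last exact: Xut.
  exact: derive1_cst.
(* Projection sends 0 to 0, so [h_uu] and [h_uv] vanish, and each product in the numerator of $K$
   contains one of them. *)
rewrite /gauss_curvature /h_uu /h_uv Xuu Xuv /normal_part !mul0mx.
by rewrite dotC !dot0r subr0 mulr0.
Qed.
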